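(* Let $p$ be a prime, $n=2k$, $\gamma\in\mathbb{F}_{p^n}^*$, $\delta\in\mathbb{F}_{p^k}$, $s$ a positive integer, and let $F:\mathbb{F}_{p^n}\to\mathbb{F}_{p^n}$, $F(x)=\gamma (f(x))^s+x$, where $f(x)=x^{p^k}+x+\delta$. Set $b=T^n_k(\gamma)=\gamma+\gamma^{p^k}$. Then: (1) If $b=0$, then $F$ is a permutation of $\mathbb{F}_{p^n}$ for any $s$, and so is $x\mapsto L(\gamma)(f(x))^s+L(x)$ for every $\mathbb{F}_{p^k}$-linear permutation $L$ of $\mathbb{F}_{p^n}$. (2) When $b=0$, $F^{-1}(x)=x+(p-1)\gamma(f(x))^s$. Notably, $F$ is an involution if and only if $p=2$. (3) When $b\neq0$, $F$ is a permutation of $\mathbb{F}_{p^n}$ if and only if $u\mapsto u+bu^s$ permutes $\mathbb{F}_{p^k}$. In particular $F$ is a permutation when $u\mapsto u^s$ is $b$-complete over $\mathbb{F}_{p^k}$.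
   Context: A function $h:\mathbb{F}_{p^k}\to\mathbb{F}_{p^k}$ is called $b$-complete if both $h$ and $u\mapsto u+bh(u)$ permute $\mathbb{F}_{p^k}$. $F^{-1}$ denotes the compositional inverse; an involution is a map with $F\circ F=\mathrm{id}$. *)

(* Defs.v *)
From HB Require Import structures.
From mathcomp Require Import all_boot all_order all_algebra all_field.

Set Implicit Arguments.
Unset Strict Implicit.
Unset Printing Implicit Defensive.

Import GRing.Theory.
Local Open Scope ring_scope.

(* The field with p^n elements is an extension L of 'F_p of dimension n, and  *)
(* its subfield with p^k elements a {subfield L} K of dimension k. Functions  *)
(* on K are represented by functions on L, only considered on K.              *)

Definition permutes_on (T : Type) (A : {pred T}) (h : T -> T) : Prop :=
  [/\ {in A, forall u, h u \in A},
      {in A &, injective h}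
    & {in A, forall v, exists2 u, u \in A & h u = v}].

Definition b_complete (R : nzRingType) (A : {pred R}) (b : R) (h : R -> R) :
    Prop :=
  permutes_on A h /\ permutes_on A (fun u => u + b * h u).

(* Linearity over the scalars in A; the library's {linear L -> L} would only  *)
(* give linearity over the base field of L.                                   *)
Definition linear_over (R : nzRingType) (A : {pred R}) (Lam : R -> R) : Prop :=
  {in A, forall a x y, Lam (a * x + y) = a * Lam x + Lam y}.

(* The relative trace from p^(2k) to p^k elements. *)
Definition rtrace (R : nzRingType) (p k : nat) (x : R) : R :=
  x + x ^+ (p ^ k).

Definition fmap (R : nzRingType) (p k : nat) (delta x : R) : R :=
  x ^+ (p ^ k) + x + delta.

Definition Fmap (R : nzRingType) (p k s : nat) (gamma delta x : R) : R :=
  gamma * fmap p k delta x ^+ s + x.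

(* Main.v *)
(* The map f takes values in F_(p^k), and f (x + gamma c) = f x + b c for c   *)
(* in F_(p^k). Hence f \o F = h \o f with h u = u + b u^s, and F is           *)
(* x |-> x + gamma (f x)^s on every fibre of f. If b = 0, then f \o F = f, so *)
(* subtracting gamma (f x)^s inverts F. If b != 0, then f maps onto F_(p^k)   *)
(* already along the line x + gamma F_(p^k), and F permutes the large field   *)
(* exactly when h permutes the small one.                                     *)

Require Import Defs.
From HB Require Import structures.
From mathcomp Require Import all_boot all_order all_algebra all_field.
From mathcomp Require Import ring.

Set Implicit Arguments.
Unset Strict Implicit.
Unset Printing Implicit Defensive.

Import GRing.Theory.
Local Open Scope ring_scope.

(** [F] moves [x] along the line [x + gamma * K], on which [f] is affine with slope [b]
    ([fmap_shift]). So [f] semiconjugates [F] to [h] ([fmap_Fmap]), and bijectivity of [F] becomes a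
    question about [h]: for [b = 0], [h] is the identity; for [b != 0], every fibre over [K] is
    nonempty ([fmap_surj]), so properties of [F] descend to [h]. *)

Lemma inj_bij_fieldExt (F0 : finFieldType) (L : fieldExtType F0) (g : L -> L) :
  injective g -> bijective g.
(* [finvect_type] equips [L] with its structure of finite type. *)
Proof. exact: (@injF_bij (finvect_type L)). Qed.

Lemma bij_surj (T U : Type) (g : T -> U) (y : U) :
  bijective g -> exists x, g x = y.
Proof. by case=> h _ hK; exists (h y). Qed.

Section HalfDegreeSubfield.

Variables (p k : nat) (p_prime : prime p) (L : fieldExtType 'F_p).
Variables (dimL : \dim {:L} = (2 * k)%N) (K : {subfield L}) (dimK : \dim K = k).

Lemma pchar_fieldExt : p \in [pchar L].
Proof. by rewrite pchar_lalg pchar_Fp. Qed.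

Lemma frobD (x y : L) : (x + y) ^+ (p ^ k) = x ^+ (p ^ k) + y ^+ (p ^ k).
Proof.
by apply: exprDn_pchar; rewrite pnatX pnatE ?pchar_fieldExt.
Qed.

Lemma mem_subfieldE (x : L) : (x \in K) = (x ^+ (p ^ k) == x).
Proof. by rewrite Fermat's_little_theorem dimK card_Fp. Qed.

Lemma frob_id (c : L) : c \in K -> c ^+ (p ^ k) = c.
Proof. by rewrite mem_subfieldE => /eqP. Qed.

(** The field has [p ^ (2 * k)] elements, so this power map is the conjugation of [L] over [K]. *)
Lemma frobK (x : L) : (x ^+ (p ^ k)) ^+ (p ^ k) = x.
Proof.
have:= memvf x; rewrite Fermat's_little_theorem dimL card_Fp //.
by rewrite mul2n -addnn expnD exprM => /eqP.
Qed.

Lemma rtrace_in (x : L) : rtrace p k x \in K.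
Proof. by rewrite mem_subfieldE frobD frobK addrC. Qed.

Lemma fmap_in (delta x : L) : delta \in K -> fmap p k delta x \in K.
Proof. by move=> dK; rewrite rpredD // addrC rtrace_in. Qed.

Lemma fmap_shift (delta gamma x c : L) : c \in K ->
  fmap p k delta (x + gamma * c) = fmap p k delta x + rtrace p k gamma * c.
Proof.
by move=> cK; rewrite /fmap /rtrace frobD exprMn (frob_id cK); ring.
Qed.

Lemma rtrace1 : rtrace p k (1 : L) = 2%:R.
Proof. by rewrite /rtrace expr1n. Qed.

Variables (s : nat) (gamma delta : L) (delta_in : delta \in K).
Let f := fmap p k delta.
Let F := Fmap p k s gamma delta.
Let b := rtrace p k gamma.
Let h (u : L) := u + b * u ^+ s.

Lemma FmapE (x : L) : F x = x + gamma * f x ^+ s.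
Proof. exact: addrC. Qed.

Lemma fmap_powN_in (x : L) : - f x ^+ s \in K.
Proof. by rewrite rpredN rpredX // fmap_in. Qed.

Lemma fmap_Fmap (x : L) : f (F x) = h (f x).
Proof. by rewrite FmapE /f fmap_shift // rpredX // fmap_in. Qed.

(** The coefficient of [gamma] solves an affine equation of slope [b]; it lies in [K] because [b]
    does. *)
Lemma fmap_surj (x u : L) : b != 0 -> u \in K ->
  f (x + gamma * ((u - f x) / b)) = u.
Proof.
move=> b_neq0 uK; rewrite /f fmap_shift.
  by rewrite mulrC divfK // addrC subrK.
by rewrite rpred_div ?rpredB ?fmap_in ?rtrace_in.
Qed.

Lemma Fmap_sub_cancel : b = 0 -> cancel F (fun x => x - gamma * f x ^+ s).
Proof. by move=> b0 x; rewrite fmap_Fmap /h b0 mul0r addr0 FmapE addrK. Qed.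

Lemma sub_Fmap_cancel : b = 0 -> cancel (fun x => x - gamma * f x ^+ s) F.
Proof.
move=> b0 x; rewrite FmapE -mulrN /f fmap_shift ?fmap_powN_in //.
by rewrite -/b b0 mul0r addr0 mulrN subrK.
Qed.

Lemma Fmap_bij_rtrace0 : b = 0 -> bijective F.
Proof.
by move=> b0; exists (fun x => x - gamma * f x ^+ s);
  [exact: Fmap_sub_cancel | exact: sub_Fmap_cancel].
Qed.

Lemma linear_Fmap_bij (Lam : L -> L) : b = 0 -> linear_over K Lam ->
  bijective Lam -> bijective (fun x => Lam gamma * f x ^+ s + Lam x).
Proof.
move=> b0 LamZ Lam_bij.
apply: (eq_bij (bij_comp Lam_bij (Fmap_bij_rtrace0 b0))) => x /=.
(* [f x ^+ s] is a scalar of [K], so the map is [Lam] after [F]. *)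
rewrite /F /Fmap [gamma * _]mulrC LamZ ?rpredX ?fmap_in //.
by rewrite [Lam gamma * _]mulrC.
Qed.

(** [F] preserves [f], so applying it twice adds [2 * gamma * f x ^+ s]. Shifts along [gamma] cannot
    change [f] here, so a point where [f] is nonzero is sought along 1, whose trace is 2. *)
Lemma Fmap_involutive : gamma != 0 -> b = 0 -> involutive F <-> p = 2%N.
Proof.
move=> gamma_neq0 b0.
have FF x : F (F x) = x + 2%:R * (gamma * f x ^+ s).
  by rewrite [LHS]FmapE fmap_Fmap /h b0 mul0r addr0 FmapE; ring.
have p_dvd2 : (2%:R == 0 :> L) = (p %| 2)%N.
  by rewrite (dvdn_pcharf pchar_fieldExt).
split=> [FK | p2 x]; last first.
  have /eqP two0 : 2%:R == 0 :> L by rewrite p_dvd2 p2.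
  by rewrite FF two0 mul0r addr0.
apply/eqP; rewrite -dvdn_prime2 // -p_dvd2; apply: contraT => two_neq0.
(* As 2 != 0, the trace of 1 does not vanish and f takes the value 1. *)
pose x : L := 0 + 1 * ((1 - f 0) / 2%:R).
have fx1 : f x = 1.
  rewrite /x /f fmap_shift; last first.
    by rewrite rpred_div ?rpredB ?rpred1 ?fmap_in ?rpred_nat.
  by rewrite rtrace1 mulrC divfK // addrC subrK.
have /eqP := FK x; rewrite FF fx1 expr1n mulr1 -subr_eq0 addrC addKr mulf_eq0.
by rewrite (negPf two_neq0) (negPf gamma_neq0).
Qed.

Lemma permutes_Fmap_bij : permutes_on K h -> bijective F.
Proof.
case=> _ h_inj _; apply: inj_bij_fieldExt => x y eqF.
have eqf : f x = f y by apply: h_inj; rewrite ?fmap_in // -!fmap_Fmap eqF.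
by move: eqF; rewrite !FmapE eqf => /addIr.
Qed.

(** Surjectivity: [f] sends the preimage under [F] of a point over [v] to a preimage of [v] under
    [h]. Injectivity: [y] is chosen so that [F y = F x] once [f y = u'], and [h u = h u'] gives the
    latter. *)
Lemma Fmap_bij_permutes : b != 0 -> bijective F -> permutes_on K h.
Proof.
move=> b_neq0 F_bij.
have hK u : u \in K -> h u \in K.
  by move=> uK; rewrite rpredD // rpredM ?rtrace_in ?rpredX.
split=> // [u u' uK u'K eq_h | v vK]; last first.
  have [x Fx] := bij_surj (0 + gamma * ((v - f 0) / b)) F_bij.
  by exists (f x); rewrite ?fmap_in // -fmap_Fmap Fx fmap_surj.
(* Points over u and u' whose images under F agree. *)
pose x := 0 + gamma * ((u - f 0) / b).
pose y := x + gamma * (u ^+ s - u' ^+ s).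
have fx : f x = u by exact: fmap_surj.
have fy : f y = u'.
  rewrite /f fmap_shift ?rpredB ?rpredX // -/(f x) fx -/b mulrBr addrA.
  by rewrite -/(h u) eq_h addrK.
rewrite -fx -fy; congr (f _); apply: (bij_inj F_bij).
by rewrite !FmapE fx fy /y; ring.
Qed.

End HalfDegreeSubfield.

Theorem proposition6 (p k s : nat) (p_prime : prime p) (s_gt0 : (0 < s)%N)
    (L : fieldExtType 'F_p) (dimL : \dim {:L} = (2 * k)%N)
    (K : {subfield L}) (dimK : \dim K = k)
    (gamma delta : L) (gamma_neq0 : gamma != 0) (delta_in : delta \in K) :
  let f := fmap p k delta in
  let F := Fmap p k s gamma delta in
  let b := rtrace p k gamma in
  [/\ b = 0 ->
        bijective F /\
        (forall Lam : L -> L, linear_over K Lam -> bijective Lam ->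
           bijective (fun x => Lam gamma * f x ^+ s + Lam x)),
      b = 0 ->
        (let G := fun x => x + (p - 1)%:R * gamma * f x ^+ s in
         cancel F G /\ cancel G F) /\
        (involutive F <-> p = 2%N)
    & b != 0 ->
        (bijective F <-> permutes_on K (fun u => u + b * u ^+ s)) /\
        (b_complete K b (fun u => u ^+ s) -> bijective F)].
Proof.
move=> f F b; split=> [b0 | b0 | b_neq0].
- split=> [|Lam LamZ Lam_bij].
    exact: (Fmap_bij_rtrace0 p_prime dimL dimK s delta_in b0).
  exact: (linear_Fmap_bij p_prime dimL dimK s delta_in b0 LamZ Lam_bij).
- split; last first.
    exact: (Fmap_involutive p_prime dimL dimK s delta_in gamma_neq0 b0).
  move=> G.
  have GE : G =1 (fun x => x - gamma * f x ^+ s).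
    (* In characteristic [p], the factor [p - 1] is -1. *)
    move=> x; rewrite /G natrB ?prime_gt0 //.
    by rewrite (pcharf0 (pchar_fieldExt p_prime L)) sub0r mulN1r mulNr.
  split=> x.
    by rewrite GE (Fmap_sub_cancel p_prime dimL dimK s delta_in b0).
  by rewrite GE; exact: (sub_Fmap_cancel p_prime dimL dimK s delta_in b0 x).
- have hF := permutes_Fmap_bij p_prime dimL dimK delta_in.
  split=> [|[_]]; last exact: hF.
  split; last exact: hF.
  exact: (Fmap_bij_permutes p_prime dimL dimK delta_in b_neq0).
Qed.
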